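(* Let $d\ge3$ be odd and define, for $x\in[-1+\tfrac2d,1]$, $m(x)=\big[\tfrac12(1-\tfrac1d)(1-\tfrac2d+x)\big]^{1/2}+\tfrac1d$. Consider the convex set $$C=\mathrm{conv}\Big\{\Big(\tfrac1d\operatorname{tr}[U\overline U],\ \tfrac1d|\operatorname{tr}U|^2\Big): U\in U(d)\Big\}\subset\mathbb{R}^2.$$ Then the extreme points of $C$ are exactly $(-1+2/d,0)$, $(1,0)$ and the points $\big(x,\,d\,m(x)^2\big)$ for $x\in[-1+2/d,1]$.
   Context: $\overline U$ is the entrywise complex conjugate. With $\mathbb{F}$ the flip on $\mathbb{C}^d\otimes\mathbb{C}^d$, $\hat{\mathbb{F}}=d|\Omega\rangle\langle\Omega|$, $|\Omega\rangle=d^{-1/2}\sum_j|jj\rangle$, the pair $(\frac1d\operatorname{tr}[U\overline U],\frac1d|\operatorname{tr}U|^2)$ equals the expectation values $(\operatorname{tr}[\rho\mathbb{F}],\operatorname{tr}[\rho\hat{\mathbb{F}}])$ in the state $\rho=(\mathbb{1}\otimes U)|\Omega\rangle\langle\Omega|(\mathbb{1}\otimes U^\dagger)$, so $C$ is the coordinate image of the $O(d)$-covariant mixtures of unitary channels. *)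

(* Defs.v *)
From HB Require Import structures.
From mathcomp Require Import all_boot all_order all_algebra.
From mathcomp Require Import complex.
From mathcomp Require Import all_classical all_reals.
Set Implicit Arguments. Unset Strict Implicit. Unset Printing Implicit Defensive.
Import Order.TTheory GRing.Theory Num.Theory.
Local Open Scope ring_scope.

Definition conj_mx (R : realType) (d : nat) (U : 'M[R[i]]_d) : 'M[R[i]]_d :=
  map_mx (@conjc R) U.

Definition unitary_mx (R : realType) (d : nat) (U : 'M[R[i]]_d) : Prop :=
  U *m (conj_mx U)^T = 1%:M.

Definition sqmod (R : realType) (z : R[i]) : R := complex.Re z ^+ 2 + complex.Im z ^+ 2.

Definition coord_pt (R : realType) (d : nat) (U : 'M[R[i]]_d) : R * R :=
  (complex.Re (\tr (U *m conj_mx U)) / d%:R, sqmod (\tr U) / d%:R).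

Definition conv2 (R : realType) (S : R * R -> Prop) : R * R -> Prop :=
  fun p => exists (n : nat) (w : 'I_n -> R) (q : 'I_n -> R * R),
    (forall i, 0 <= w i) /\ \sum_(i < n) w i = 1 /\ (forall i, S (q i)) /\
    p = (\sum_(i < n) w i * (q i).1, \sum_(i < n) w i * (q i).2).

Definition extreme_point (R : realType) (C : R * R -> Prop) (p : R * R) : Prop :=
  C p /\ forall a b t, C a -> C b -> 0 < t -> t < 1 ->
    p = (t * a.1 + (1 - t) * b.1, t * a.2 + (1 - t) * b.2) -> a = p /\ b = p.

Definition Cset (R : realType) (d : nat) : R * R -> Prop :=
  conv2 (fun p => exists U : 'M[R[i]]_d, unitary_mx U /\ p = coord_pt U).

Definition mfun (R : realType) (d : nat) (x : R) : R :=
  Num.sqrt (2^-1 * (1 - d%:R^-1) * (1 - 2 / d%:R + x)) + d%:R^-1.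

(* Main.v *)
(** Write [U = S + A] with [S] symmetric and [A] antisymmetric; then
    [tr (U conj(U)) = 2 |S|^2 - d] (Frobenius norm) and [tr U = tr S].  As [d] is
    odd, [A] kills a unit vector [v], and [u = S v = U v = U^T v] is a unit vector
    with [S^* u = v].  Removing [u v^*] from [S] and applying Cauchy-Schwarz to
    the rest gives [|tr U| <= 1 + sqrt ((d - 1) (|S|^2 - 1))], which is
    [|tr U| <= d m(x)], together with [|S|^2 >= 1].  Hence [C] lies below the
    strictly concave curve [y = d m(x)^2], above [y = 0] and between
    [x = -1 + 2/d] and [x = 1].  Sums of plane rotations realize the curve, and
    explicit traceless unitaries realize the two bottom corners. *)
Require Import Defs.
From HB Require Import structures.
From mathcomp Require Import all_boot all_order all_algebra.
From mathcomp Require Import complex.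
From mathcomp Require Import all_classical all_reals.
From mathcomp Require Import ring lra.
Import Order.TTheory GRing.Theory Num.Theory.
Local Open Scope ring_scope.
Set Implicit Arguments. Unset Strict Implicit. Unset Printing Implicit Defensive.

(** * The trace inequality for unitary matrices of odd size *)

Section TraceInequality.
Local Open Scope sesquilinear_scope.
Variable C : numClosedFieldType.

Lemma adjmxM m n p (A : 'M[C]_(m, n)) (B : 'M[C]_(n, p)) :
  (A *m B) ^t* = B ^t* *m A ^t*.
Proof. by rewrite trmx_mul map_mxM. Qed.

Lemma adjmxB m n (A B : 'M[C]_(m, n)) : (A - B) ^t* = A ^t* - B ^t*.
Proof. by rewrite linearB map_mxB. Qed.

Lemma adjmxZ m n (a : C) (A : 'M[C]_(m, n)) : (a *: A) ^t* = a^* *: A ^t*.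
Proof. by rewrite linearZ map_mxZ. Qed.

Lemma mxtrace_adj n (A : 'M[C]_n) : \tr (A ^t*) = (\tr A)^*.
Proof. by rewrite trace_map_mx mxtrace_tr. Qed.

Lemma mxtrace_mul_adjE m n (A : 'M[C]_(m, n)) :
  \tr (A *m A ^t*) = \sum_i \sum_j `|A i j| ^+ 2.
Proof.
apply: eq_bigr => i _; rewrite mxE; apply: eq_bigr => j _.
by rewrite !mxE normCK.
Qed.

Lemma mxtrace_mul_adj_ge0 m n (A : 'M[C]_(m, n)) : 0 <= \tr (A *m A ^t*).
Proof.
rewrite mxtrace_mul_adjE; apply: sumr_ge0 => i _; apply: sumr_ge0 => j _.
exact: exprn_ge0.
Qed.

Lemma mxtrace_mul_adj_gt0 m n (A : 'M[C]_(m, n)) :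
  A != 0 -> 0 < \tr (A *m A ^t*).
Proof.
rewrite lt_def mxtrace_mul_adj_ge0 andbT; apply: contra => A0.
apply/eqP/matrixP => i j; rewrite mxE; apply/eqP.
move: A0; rewrite mxtrace_mul_adjE psumr_eq0; last first.
  by move=> k _; apply: sumr_ge0 => l _; exact: exprn_ge0.
move/allP => /(_ i (mem_index_enum _)); rewrite psumr_eq0; last first.
  by move=> l _; exact: exprn_ge0.
by move/allP => /(_ j (mem_index_enum _)); rewrite sqrf_eq0 normr_eq0.
Qed.

(** With [b = |B|^2] and [t] the trace on the left, [b A - t B] has squared norm
    [b (|A|^2 b - |t|^2)], which is nonnegative, and [b > 0] unless [B = 0]. *)
Lemma mxtrace_CauchySchwarz m n (A B : 'M[C]_(m, n)) :
  `|\tr (A *m B ^t*)| ^+ 2 <= \tr (A *m A ^t*) * \tr (B *m B ^t*).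
Proof.
have [->|B0] := eqVneq B 0.
  by rewrite linear0 map_mx0 !mulmx0 mxtrace0 mulr0 normr0 expr0n.
have b_gt0 := mxtrace_mul_adj_gt0 B0.
set a := \tr (A *m A ^t*); set b := \tr (B *m B ^t*) in b_gt0 *.
set t := \tr (A *m B ^t*).
have tJ : \tr (B *m A ^t*) = t^* by rewrite -mxtrace_adj adjmxM trmxCK.
have bJ : b^* = b by rewrite conj_Creal // ger0_real // ltW.
have := mxtrace_mul_adj_ge0 (b *: A - t *: B).
rewrite adjmxB !adjmxZ bJ mulmxBl !mulmxBr -!scalemxAl -!scalemxAr !scalerA.
rewrite !linearB !linearZ /= -/a -/b -/t tJ normCK.
have -> : b * b * a - b * t^* * t - (t * b * t^* - t * t^* * b) =
  b * (a * b - t * t^*) by ring.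
by rewrite pmulr_rge0 // subr_ge0.
Qed.

(* Split [S = u v^* + S'] with [S' v = 0]; then [tr S' = tr (S' P)] for the rank
   [n - 1] projection [P = 1 - v v^*], and Cauchy-Schwarz applies. *)
Lemma mxtrace_unit_pair n (S : 'M[C]_n) (u v : 'cV[C]_n) :
  \tr (u *m u ^t*) = 1 -> v ^t* *m v = 1%:M -> S *m v = u -> S ^t* *m u = v ->
  exists a b : C, [/\ \tr S = a + b, `|a| <= 1 &
    `|b| ^+ 2 <= (\tr (S *m S ^t*) - 1) * (n%:R - 1)].
Proof.
move=> u1 vv Sv Su.
have v1 : \tr (v *m v ^t*) = 1 by rewrite mxtrace_mulC vv mxtrace1.
have vS : v ^t* *m S ^t* = u ^t* by rewrite -adjmxM Sv.
have uS : u ^t* *m S = v ^t* by rewrite -Su adjmxM trmxCK.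
exists (\tr (u *m v ^t*)), (\tr (S - u *m v ^t*)); split.
- by rewrite linearB /= addrC subrK.
- rewrite -(expr_le1 (n := 2)) //.
  by have := mxtrace_CauchySchwarz u v; rewrite u1 v1 mulr1.
pose P := 1%:M - v *m v ^t*.
have PJ : P ^t* = P.
  by rewrite adjmxB adjmxM trmxCK trmx1 map_mx1.
have PP : P *m P = P.
  rewrite /P mulmxBr mulmx1 mulmxBl mul1mx mulmxA -(mulmxA v) vv mulmx1.
  by rewrite subrr subr0.
have SP : (S - u *m v ^t*) *m P ^t* = S - u *m v ^t*.
  rewrite PJ mulmxBr mulmx1 mulmxBl !mulmxA Sv -(mulmxA u) vv mulmx1.
  by rewrite subrr subr0.
have := mxtrace_CauchySchwarz (S - u *m v ^t*) P.
rewrite SP PJ PP.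
suff -> : \tr ((S - u *m v ^t*) *m (S - u *m v ^t*) ^t*) = \tr (S *m S ^t*) - 1.
  by rewrite [\tr P]linearB /= v1 mxtrace1.
rewrite adjmxB adjmxM trmxCK mulmxBl !mulmxBr !mulmxA Sv.
rewrite -(mulmxA u) vS -(mulmxA u) vv mulmx1 subrr subr0.
by rewrite linearB /= u1.
Qed.

(** Transposition keeps the determinant and negation in odd size reverses its sign, so it vanishes;
    a kernel vector is then normalized. *)
Lemma antisym_odd_kernel n (A : 'M[C]_n) : odd n -> A^T = - A ->
  exists v : 'cV[C]_n, v ^t* *m v = 1%:M /\ A *m v = 0.
Proof.
move=> on AT.
have detA : \det A^T = 0.
  have : \det A^T = - \det A^T.
    by rewrite {1}AT -scaleN1r detZ -signr_odd on expr1 mulN1r det_tr.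
  move/eqP; rewrite -subr_eq0 opprK -mulr2n -mulr_natr mulf_eq0 pnatr_eq0 orbF.
  by move/eqP.
have /det0P [w w0 wA] : \det A^T == 0 by apply/eqP.
have wT0 : w^T != 0 by rewrite trmx_eq0.
have s_gt0 := mxtrace_mul_adj_gt0 wT0.
set s := \tr _ in s_gt0.
exists ((sqrtC s)^-1 *: w^T); split; last first.
  by rewrite -scalemxAr -[A]trmxK -trmx_mul wA trmx0 scaler0.
have rJ : (sqrtC s)^-1^* = (sqrtC s)^-1.
  by rewrite conj_Creal // ger0_real // invr_ge0 sqrtC_ge0 ltW.
rewrite adjmxZ rJ -scalemxAl -scalemxAr scalerA -invfM -expr2 sqrtCK.
rewrite [_ *m _]mx11_scalar -trace_mx11 mxtrace_mulC -/s.
by rewrite scale_scalar_mx mulVf // gt_eqF.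
Qed.

(** A unit vector [v] killed by [U - U^T] and its image [U v] form the unit pair for the symmetric
    part [S], whose squared norm is [(n + tr (U conj(U))) / 2]. *)
Lemma unitary_trace_decomposition n (U : 'M[C]_n) : odd n -> U *m U ^t* = 1%:M ->
  exists a b : C, [/\ \tr U = a + b, `|a| <= 1 &
    `|b| ^+ 2 <= ((n%:R + \tr (U *m map_mx Num.Def.conjC U)) / 2 - 1) * (n%:R - 1)].
Proof.
move=> on UU; have UU' : U ^t* *m U = 1%:M by apply: mulmx1C.
pose S := 2^-1 *: (U + U^T).
have two0 : (2 : C) != 0 by rewrite pnatr_eq0.
have [v [vv Av]] : exists v : 'cV[C]_n, v ^t* *m v = 1%:M /\ (U - U^T) *m v = 0.
  by apply: antisym_odd_kernel; rewrite // linearB /= trmxK opprB.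
have UTv : U^T *m v = U *m v.
  by apply/eqP; rewrite eq_sym -subr_eq0 -mulmxBl Av.
have ST : \tr S = \tr U.
  by rewrite mxtraceZ mxtraceD mxtrace_tr -mulr2n -[\tr U *+ 2]mulr_natl mulKf.
have trUT : \tr (U^T *m U ^t*) = \tr (U *m map_mx Num.Def.conjC U).
  by rewrite -map_trmx -trmx_mul mxtrace_tr mxtrace_mulC.
have UcU : U^T *m map_mx Num.Def.conjC U = 1%:M.
  by rewrite -[map_mx _ U]trmxK -trmx_mul map_trmx UU' trmx1.
have UcU' : map_mx Num.Def.conjC U *m U^T = 1%:M by apply: mulmx1C.
have SJ : S ^t* = 2^-1 *: (U ^t* + map_mx Num.Def.conjC U).
  rewrite adjmxZ linearD /= trmxK map_mxD fmorphV /= conjC_nat.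
  by rewrite addrC.
have -> : (n%:R + \tr (U *m map_mx Num.Def.conjC U)) / 2 = \tr (S *m S ^t*).
  rewrite SJ -scalemxAl -scalemxAr scalerA mulmxDl !mulmxDr UU UcU mxtraceZ !mxtraceD.
  by rewrite mxtrace1 trUT; field.
rewrite -ST; apply: (@mxtrace_unit_pair n S (U *m v) v) => //.
- rewrite adjmxM mxtrace_mulC -mulmxA (mulmxA _ U) UU' mul1mx vv.
  by rewrite mxtrace1.
- by rewrite -scalemxAl mulmxDl UTv -mulr2n -scaler_nat scalerA mulVf // scale1r.
(* Since [U v = U^T v], while [U^*] inverts [U] and [conj(U)] inverts [U^T], both halves of [S^*]
   send [U v] to [v / 2]. *)
- rewrite SJ -scalemxAl mulmxDl mulmxA UU' mul1mx -UTv mulmxA UcU' mul1mx.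
  by rewrite -mulr2n -scaler_nat scalerA mulVf // scale1r.
Qed.

End TraceInequality.

(** * The region under the curve and the strict concavity of its boundary *)

Section Region.
Local Open Scope sesquilinear_scope.
Variables (R : realType) (d : nat).
Hypotheses (d_ge3 : (3 <= d)%N) (d_odd : odd d).
Local Notation D := (d%:R : R).
Implicit Types (p : R * R) (x : R).

Let D_ge3 : 3 <= D. Proof. by rewrite ler_nat. Qed.
Let D_gt0 : 0 < D. Proof. by apply: lt_le_trans D_ge3; rewrite ltr0n. Qed.
Let D_neq0 : D != 0. Proof. by rewrite gt_eqF. Qed.
Let c_gt0 : 0 < 2^-1 * (1 - D^-1).
Proof.
rewrite mulr_gt0 ?invr_gt0 // subr_gt0 invf_lt1 //.
by apply: lt_le_trans D_ge3; rewrite ltr1n.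
Qed.

Definition radicand x : R := 2^-1 * (1 - D^-1) * (1 - 2 / D + x).

(** An outer bound for [Cset]: the listed points admit no proper splitting even inside it. *)
Definition in_region p : Prop :=
  [/\ -1 + 2 / D <= p.1, p.1 <= 1, 0 <= p.2 & p.2 <= D * mfun d p.1 ^+ 2].

(** With [d x = Re tr (U conj(U))] the first factor is [|S|^2 - 1], so [d^2 radicand x] is the bound
    on [|b|^2] from [unitary_trace_decomposition]. *)
Lemma radicandE x :
  radicand x = (D * (1 + x) / 2 - 1) * (D - 1) / D ^+ 2.
Proof. by rewrite /radicand; field. Qed.

Lemma radicand_ge0 x : (0 <= radicand x) = (-1 + 2 / D <= x).
Proof.
by rewrite /radicand pmulr_rge0 //; apply/idP/idP; lra.
Qed.

Lemma radicand_inj : injective radicand.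
Proof.
move=> x y; rewrite /radicand.
by move=> /(mulfI (lt0r_neq0 c_gt0)) /addrI.
Qed.

Lemma curveE x : -1 + 2 / D <= x ->
  D * mfun d x ^+ 2 = D * radicand x + 2 * Num.sqrt (radicand x) + D^-1.
Proof.
rewrite -radicand_ge0 => /sqr_sqrtr rx.
by rewrite -{1}rx /mfun -/(radicand x); field.
Qed.

Lemma curve_gt0 x : 0 < D * mfun d x ^+ 2.
Proof.
rewrite mulr_gt0 // exprn_gt0 // /mfun ltr_wpDl ?sqrtr_ge0 //.
by rewrite invr_gt0.
Qed.

Lemma sqmodE (z : R[i]) : (sqmod z)%:C%C = `|z| ^+ 2.
Proof. exact: add_Re2_Im2. Qed.

(** Cauchy-Schwarz for [U] and [U^T], both of squared norm [d], as [conj(U)] is the adjoint of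
    [U^T]. *)
Lemma Re_mxtrace_conj_le (U : 'M[R[i]]_d) : unitary_mx U ->
  complex.Re (\tr (U *m conj_mx U)) <= D.
Proof.
move=> UU.
have UU1 : U *m U ^t* = 1%:M by rewrite -map_trmx.
have UcU : U^T *m conj_mx U = 1%:M.
  by rewrite -[conj_mx U]trmxK -trmx_mul (mulmx1C UU) trmx1.
have := mxtrace_CauchySchwarz U U^T.
rewrite trmxK UU1 -/(conj_mx U) UcU mxtrace1 -expr2 ler_pXn2r ?nnegrE ?ler0n //.
have -> : (d%:R : R[i]) = D%:C%C by rewrite rmorph_nat.
move=> T_le; rewrite -lecR; apply: le_trans T_le.
apply: le_trans (normc_ge_Re _); rewrite lecR; exact: ler_norm.
Qed.

Lemma coord_pt_in_region (U : 'M[R[i]]_d) :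
  unitary_mx U -> in_region (coord_pt U).
Proof.
move=> UU.
have UU1 : U *m U ^t* = 1%:M by rewrite -map_trmx.
have [a [b [trU a1 b1]]] := unitary_trace_decomposition d_odd UU1.
set T := \tr (U *m _) in b1.
have Td : complex.Re T = D * (coord_pt U).1 by rewrite /coord_pt /=; field.
have x_le1 : (coord_pt U).1 <= 1.
  rewrite /coord_pt /= ler_pdivrMr // mul1r; exact: Re_mxtrace_conj_le.
have b2 : sqmod b <= D ^+ 2 * radicand (coord_pt U).1.
  move: b1; rewrite -sqmodE [T]complexE.
  (* The complex order compares real parts and demands equal imaginary parts; separating the two
     lets the real inequality be read off. *)
  have -> : ((d%:R + ((complex.Re T)%:C + 'i * (complex.Im T)%:C)%C) / 2 - 1) * (d%:R - 1) =
    (((D + complex.Re T) / 2 - 1) * (D - 1))%:C%C + ('i * (complex.Im T / 2 * (D - 1))%:C)%C.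
    rewrite !(rmorphM, rmorphB, rmorphD, fmorphV, rmorph_nat, rmorph1) /=.
    by field.
  rewrite lecE => /andP[_] /=; rewrite !mul0r !mul1r subr0 addr0 Td => b1.
  apply: le_trans b1 _; rewrite radicandE le_eqVlt; apply/orP; left; apply/eqP.
  by field.
(* The left edge is where the radicand vanishes; [d^2] times the radicand dominates [|b|^2], so it
   is nonnegative. *)
have x_ge : -1 + 2 / D <= (coord_pt U).1.
  rewrite -radicand_ge0 -(pmulr_rge0 _ (exprn_gt0 2 D_gt0)).
  by apply: le_trans b2; rewrite addr_ge0 ?sqr_ge0.
split=> //; first by rewrite divr_ge0 // addr_ge0 ?sqr_ge0.
have b3 : `|b| <= (D * Num.sqrt (radicand (coord_pt U).1))%:C%C.
  have -> : D * Num.sqrt (radicand (coord_pt U).1) =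
      Num.sqrt (D ^+ 2 * radicand (coord_pt U).1).
    by rewrite (sqrtrM _ (sqr_ge0 D)) sqrtr_sqr ger0_norm ?ltW.
  by rewrite normc_def lecR ler_wsqrtr.
have tr_le : `|\tr U| <= (D * mfun d (coord_pt U).1)%:C%C.
  rewrite trU (le_trans (ler_normD _ _)) // (le_trans (lerD a1 b3)) //.
  by rewrite -(rmorph1 (real_complex R)) -rmorphD lecR /mfun mulrDr mulfV // addrC.
rewrite ler_pdivrMr // -lecR sqmodE.
have -> : D * mfun d (coord_pt U).1 ^+ 2 * D = (D * mfun d (coord_pt U).1) ^+ 2.
  by ring.
rewrite rmorphXn ler_pXn2r ?nnegrE //.
by apply: le_trans tr_le.
Qed.

(** The gap between the mean of [a] and the square of the mean [mu] of its roots is the variance of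
    the roots. *)
Lemma sqrt_Jensen n (w a : 'I_n -> R) :
  (forall i, 0 <= w i) -> \sum_(i < n) w i = 1 -> (forall i, 0 <= a i) ->
  \sum_(i < n) w i * Num.sqrt (a i) <= Num.sqrt (\sum_(i < n) w i * a i).
Proof.
move=> w_ge0 w1 a_ge0; set mu := \sum_(i < n) w i * Num.sqrt (a i).
have mu_ge0 : 0 <= mu by apply: sumr_ge0 => i _; rewrite mulr_ge0 ?sqrtr_ge0.
rewrite -(ger0_norm mu_ge0) -sqrtr_sqr ler_wsqrtr // -subr_ge0.
have -> : \sum_(i < n) w i * a i - mu ^+ 2 =
    \sum_(i < n) w i * (Num.sqrt (a i) - mu) ^+ 2.
  transitivity (\sum_(i < n) (w i * a i
      + ((w i * mu ^+ 2) - (w i * Num.sqrt (a i)) * (2 * mu)))).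
    rewrite big_split sumrB /= -!mulr_suml w1 -/mu; ring.
  by apply: eq_bigr => i _; rewrite -{1}(sqr_sqrtr (a_ge0 i)); ring.
by apply: sumr_ge0 => i _; rewrite mulr_ge0 ?sqr_ge0.
Qed.

(** Three of the inequalities are affine. For the curve, [radicand] is affine in [x], so only the
    square root term needs Jensen. *)
Lemma in_region_conv2 p : conv2 in_region p -> in_region p.
Proof.
case=> n [w [q [w_ge0 [w1 [q_in ->]]]]].
have wsum (c : R) : \sum_(i < n) w i * c = c by rewrite -mulr_suml w1 mul1r.
have x_ge : -1 + 2 / D <= \sum_(i < n) w i * (q i).1.
  rewrite -(wsum (-1 + 2 / D)); apply: ler_sum => i _.
  by rewrite ler_wpM2l //; case: (q_in i).
split=> //=.
- rewrite -(wsum 1); apply: ler_sum => i _.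
  by rewrite ler_wpM2l //; case: (q_in i).
- by apply: sumr_ge0 => i _; rewrite mulr_ge0 //; case: (q_in i).
have r_ge0 i : 0 <= radicand (q i).1 by rewrite radicand_ge0; case: (q_in i).
have rsum : radicand (\sum_(i < n) w i * (q i).1) =
    \sum_(i < n) w i * radicand (q i).1.
  rewrite /radicand mulrDr mulr_sumr -[X in X + _]wsum -big_split /=.
  by apply: eq_bigr => i _; ring.
rewrite curveE // rsum.
apply: (@le_trans _ _ (\sum_(i < n) w i * (D * radicand (q i).1
   + 2 * Num.sqrt (radicand (q i).1) + D^-1))).
  apply: ler_sum => i _; rewrite ler_wpM2l // -curveE; by case: (q_in i).
have -> : \sum_(i < n) w i * (D * radicand (q i).1
     + 2 * Num.sqrt (radicand (q i).1) + D^-1) =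
   D * (\sum_(i < n) w i * radicand (q i).1) +
   2 * (\sum_(i < n) w i * Num.sqrt (radicand (q i).1)) + D^-1.
  rewrite -[X in _ = _ + X]wsum !mulr_sumr -!big_split /=.
  by apply: eq_bigr => i _; ring.
by rewrite lerD2r lerD2l ler_pM2l // sqrt_Jensen.
Qed.

(* On the curve, [y] is affine in [radicand x] plus twice its square root, so it
   is strictly concave. *)
Lemma curve_extreme x (a b : R * R) t : -1 + 2 / D <= x ->
  in_region a -> in_region b -> 0 < t -> t < 1 ->
  (x, D * mfun d x ^+ 2) =
    (t * a.1 + (1 - t) * b.1, t * a.2 + (1 - t) * b.2) ->
  a = (x, D * mfun d x ^+ 2) /\ b = (x, D * mfun d x ^+ 2).
Proof.
case: a => a1 a2; case: b => b1 b2.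
move=> x_ge [/= a_ge _ _ a2_le] [/= b_ge _ _ b2_le] t_gt0 t_lt1 [xE yE].
have u_gt0 : 0 < 1 - t by rewrite subr_gt0.
have rx : radicand x = t * radicand a1 + (1 - t) * radicand b1.
  by rewrite xE /radicand; ring.
set sa := Num.sqrt (radicand a1); set sb := Num.sqrt (radicand b1).
set sx := Num.sqrt (radicand x).
have sa2 : sa ^+ 2 = radicand a1 by rewrite sqr_sqrtr ?radicand_ge0.
have sb2 : sb ^+ 2 = radicand b1 by rewrite sqr_sqrtr ?radicand_ge0.
have sx2 : sx ^+ 2 = radicand x by rewrite sqr_sqrtr ?radicand_ge0.
(* Averaging the upper bounds on [a2] and [b2] and comparing with the curve at [x], the terms affine
   in the radicand cancel. *)
have sx_le : sx <= t * sa + (1 - t) * sb.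
  have := lerD (ler_wpM2l (ltW t_gt0) a2_le) (ler_wpM2l (ltW u_gt0) b2_le).
  rewrite -yE !curveE // -/sa -/sb -/sx rx -subr_ge0.
  rewrite [X in 0 <= X -> _](_ : _ = 2 * (t * sa + (1 - t) * sb - sx)); last ring.
  by rewrite pmulr_rge0 // subr_ge0.
(* The variance [t (1 - t) (sa - sb)^2] is at most 0 by [sx_le], so the roots agree, and with them
   the abscissas. *)
have sab : sa = sb.
  apply/eqP; rewrite -subr_eq0 -sqrf_eq0 eq_le sqr_ge0 andbT.
  rewrite -(pmulr_rle0 _ (mulr_gt0 t_gt0 u_gt0)).
  have -> : t * (1 - t) * (sa - sb) ^+ 2 = sx ^+ 2 - (t * sa + (1 - t) * sb) ^+ 2.
    by rewrite sx2 rx -sa2 -sb2; ring.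
  rewrite subr_le0 ler_pXn2r ?nnegrE ?sqrtr_ge0 //.
  by rewrite addr_ge0 // mulr_ge0 ?sqrtr_ge0 // ltW.
have ab : a1 = b1 by apply: radicand_inj; rewrite -sa2 -sb2 sab.
have a1x : a1 = x by rewrite xE -ab; ring.
rewrite -ab a1x in b2_le *; rewrite a1x in a2_le.
(* Two heights bounded by the curve whose proper average lies on it must both lie on it. *)
have b2E : b2 = D * mfun d x ^+ 2.
  apply/eqP; rewrite eq_le b2_le /= -(ler_pM2l u_gt0).
  by rewrite -(lerD2l (t * a2)) -yE; nra.
have a2E : a2 = D * mfun d x ^+ 2.
  apply/eqP; rewrite eq_le a2_le /= -(ler_pM2l t_gt0).
  by rewrite -(lerD2r ((1 - t) * b2)) -yE; nra.
by rewrite a2E b2E.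
Qed.

End Region.

(** * Unitaries realizing the curve and the two bottom corners *)

Lemma mxtrace_mul_delta (F : pzSemiRingType) n (G : 'M[F]_n) i j :
  \tr (G *m delta_mx i j) = G j i.
Proof.
rewrite /mxtrace (bigD1 j) //= big1 ?addr0 => [|l lj].
  rewrite mxE (bigD1 i) //= big1 ?addr0 => [|m mi].
    by rewrite mxE !eqxx mulr1.
  by rewrite mxE (negPf mi) mulr0.
by rewrite mxE big1 // => m _; rewrite mxE (negPf lj) andbF mulr0.
Qed.

Section Witnesses.
Variables (R : realType) (k : nat).
Local Notation d := (1 + (k + k))%N.
Local Notation D := (d%:R : R).
Implicit Types (a b c e : R[i]).

(** The direct sum of 1 and the 2 by 2 matrix with rows [a b] and [c e] tensored with the identity
    of size [k]; products and unitarity reduce to 2 by 2 arithmetic. *)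
Definition blockU a b c e : 'M[R[i]]_d :=
  block_mx 1%:M 0 0 (block_mx a%:M b%:M c%:M e%:M).

Lemma conj_blockU a b c e : conj_mx (blockU a b c e) = blockU a^* b^* c^* e^*.
Proof.
by rewrite /conj_mx !map_block_mx !map_scalar_mx !map_mx0 rmorph1.
Qed.

Lemma mul_blockU a b c e a' b' c' e' :
  blockU a b c e *m blockU a' b' c' e' =
  blockU (a * a' + b * c') (a * b' + b * e') (c * a' + e * c') (c * b' + e * e').
Proof.
rewrite mulmx_block !mul0mx !mulmx0 mul1mx addr0 add0r !addr0.
rewrite (mulmx_block a%:M) -!scalar_mxM -!raddfD.
by rewrite add0r.
Qed.

Lemma mxtrace_blockU a b c e : \tr (blockU a b c e) = 1 + (a + e) *+ k.
Proof. by rewrite !mxtrace_block !mxtrace_scalar mulrnDl. Qed.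

Lemma unitary_blockU a b c e : a * a^* + b * b^* = 1 -> a * c^* + b * e^* = 0 ->
  c * c^* + e * e^* = 1 -> unitary_mx (blockU a b c e).
Proof.
move=> ab ac ce; rewrite /unitary_mx conj_blockU.
have -> : (blockU a^* b^* c^* e^*)^T = blockU a^* c^* b^* e^*.
  by rewrite /blockU !tr_block_mx !tr_scalar_mx !trmx0.
rewrite mul_blockU ab ac ce.
have -> : c * a^* + e * b^* = 0.
  by rewrite -[LHS]conjCK rmorphD !rmorphM /= !conjCK mulrC (mulrC _ b) ac rmorph0.
by rewrite /blockU !raddf0 -!scalar_mx_block.
Qed.


Lemma coord_blockU a b c e : coord_pt (blockU a b c e) =
  ((1 + complex.Re (a * a^* + b * c^* + (c * b^* + e * e^*)) *+ k) / D,
   sqmod (1 + (a + e) *+ k) / D).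
Proof.
by rewrite /coord_pt conj_blockU mul_blockU !mxtrace_blockU raddfD /= raddfMn.
Qed.

(* The direct sum of [1] and [k] copies of a plane rotation of cosine [C]. *)
Lemma curve_attained (x : R) : (0 < k)%N -> -1 + 2 / D <= x -> x <= 1 ->
  exists U : 'M[R[i]]_d, unitary_mx U /\ (x, D * mfun d x ^+ 2) = coord_pt U.
Proof.
move=> k_gt0 x_ge x_le1.
have D_ge3 : (3 <= d)%N by rewrite add1n ltnS (leq_add k_gt0 k_gt0).
have r_ge0 := x_ge; rewrite -(radicand_ge0 D_ge3) in r_ge0.
have kR : 0 < k%:R :> R by rewrite ltr0n.
have DE : D = 1 + 2 * k%:R by rewrite !natrD; ring.
have D_gt0 : 0 < D by rewrite ltr0n.
(* Chosen so that the trace [1 + 2 k C] equals [d m(x)]. *)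
pose C := Num.sqrt (radicand d x) * D / (2 * k%:R).
have C2 : C ^+ 2 = (D * (1 + x) / 2 - 1) / (2 * k%:R).
  rewrite /C !exprMn sqr_sqrtr // radicandE // DE.
  by field; rewrite !gt_eqF //; lra.
(* As [d - 1 = 2 k], this amounts to [x <= 1]. *)
have C2_le1 : C ^+ 2 <= 1.
  rewrite C2 ler_pdivrMr ?mulr_gt0 // mul1r.
  have : D * (1 + x) <= D * 2 by rewrite ler_pM2l //; lra.
  by rewrite DE; lra.
pose S := Num.sqrt (1 - C ^+ 2).
have S2 : S ^+ 2 = 1 - C ^+ 2 by rewrite sqr_sqrtr // subr_ge0.
have conj_real (r : R) : (r%:C%C)^* = r%:C%C by rewrite conj_Creal // complex_real.
exists (blockU C%:C%C S%:C%C (- S)%:C%C C%:C%C); split.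
  apply: unitary_blockU; rewrite !conj_real -!rmorphM -rmorphD
    -?(rmorph1 (real_complex R)) -?(rmorph0 (real_complex R)); congr (_%:C%C).
  - by rewrite -!expr2 S2; ring.
  - by ring.
  - by rewrite mulrNN -!expr2 S2; ring.
rewrite coord_blockU !conj_real -!rmorphM -!rmorphD -rmorphMn.
rewrite -(rmorph1 (real_complex R)) -rmorphD /=.
congr (_, _).
  by rewrite mulrN mulNr -!expr2 S2 C2 DE; field; rewrite !gt_eqF //; lra.
rewrite /sqmod /= expr0n addr0 /mfun -/(radicand d x).
have -> : Num.sqrt (radicand d x) = C * (2 * k%:R) / D.
  by rewrite /C DE; field; rewrite !gt_eqF //; lra.
by rewrite DE; field; rewrite gt_eqF //; lra.
Qed.

(* The phase [a] has real part [- 1 / 2k], so that the trace [1 + 2k Re a] vanishes. *)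
Lemma right_corner_attained : (0 < k)%N ->
  exists U : 'M[R[i]]_d, unitary_mx U /\ (1, 0) = coord_pt U.
Proof.
move=> k_gt0; have kR : 1 <= k%:R :> R by rewrite ler1n.
have DE : D = 1 + 2 * k%:R by rewrite !natrD; ring.
pose r : R := (2 * k%:R)^-1.
have r2_le1 : 0 <= 1 - r ^+ 2.
  have r_ge0 : 0 <= r by rewrite invr_ge0; lra.
  by rewrite subr_ge0 expr_le1 // invf_le1; lra.
pose a : R[i] := (- r +i* Num.sqrt (1 - r ^+ 2))%C.
have aa : a * a^* = 1.
  by rewrite -normCK -add_Re2_Im2 /= sqrrN sqr_sqrtr // addrC subrK.
exists (blockU a 0 0 a^*); split.
  apply: unitary_blockU; rewrite !conjC0 ?mulr0 ?mul0r ?addr0 ?add0r //.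
  by rewrite conjCK mulrC.
rewrite coord_blockU !conjC0 !conjCK !mulr0 addr0 add0r (mulrC a^*) aa.
have -> : 1 + (a + a^*) *+ k = 0.
  rewrite [a + _]addcJ -mulr_natr /= rmorphN.
  rewrite fmorphV rmorphM !rmorph_nat; field.
  by rewrite pnatr_eq0 -lt0n.
rewrite /sqmod /= expr0n addr0 mul0r; congr (_, _).
by rewrite DE; field; lra.
Qed.

(* [U = V G V^T] where [G] is the identity on the first coordinate and a complex
   structure on the others.  The symmetric part of [U] is [v v^T], with [v] the
   first column of [V], so [U] is traceless as soon as [v^T v = 0]; here
   [v = (e0 + i e1) / sqrt 2]. *)
Lemma left_corner_attained : (0 < k)%N ->
  exists U : 'M[R[i]]_d, unitary_mx U /\ (-1 + 2 / D, 0) = coord_pt U.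
Proof.
move=> k_gt0.
have DE : D = 1 + 2 * k%:R by rewrite !natrD; ring.
pose i0 : 'I_d := lshift (k + k) ord0.
pose i1 : 'I_d := rshift 1 (lshift k (Ordinal k_gt0)).
(* [E] projects onto the plane of the coordinates [i0], [i1] and [F] swaps them, so [E] is the unit
   and [F] an involution on that plane. *)
pose E : 'M[R[i]]_d := delta_mx i0 i0 + delta_mx i1 i1.
pose F : 'M[R[i]]_d := delta_mx i0 i1 + delta_mx i1 i0.
have d01 i j : delta_mx i i0 *m delta_mx i1 j = 0 :> 'M[R[i]]_d.
  exact: mul_delta_mx_0.
have d10 i j : delta_mx i i1 *m delta_mx i0 j = 0 :> 'M[R[i]]_d.
  exact: mul_delta_mx_0.
have dmxE := (@mulmxDl, @mulmxDr, @mul_delta_mx, d01, d10, @addr0, @add0r).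
have EE : E *m E = E by rewrite /E !dmxE.
have EF : E *m F = F by rewrite /E /F !dmxE.
have FE : F *m E = F by rewrite /E /F !dmxE.
have FF : F *m F = E by rewrite /E /F !dmxE.
pose al : R[i] := (Num.sqrt 2^-1)%:C%C.
have alal : al * al = 2^-1.
  by rewrite -rmorphM -expr2 sqr_sqrtr ?invr_ge0 // fmorphV rmorph_nat.
have alJ : al^* = al by rewrite conj_Creal // complex_real.
(* [V z] is [(E + z F) / sqrt 2] on the plane and the identity off it; it is symmetric, and unitary
   at [z = 'i]. *)
pose V (z : R[i]) := 1%:M + (al - 1) *: E + (al * z) *: F.
have VV z w : V z *m V w = 1%:M + ((1 + z * w) / 2 - 1) *: E + ((z + w) / 2) *: F.
  rewrite /V !mulmxDl !mulmxDr !mul1mx !mulmx1 -!scalemxAl -!scalemxAr.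
  rewrite EE EF FE FF !scalerA.
  clearbody E F; apply/matrixP => i j; rewrite !mxE.
  by rewrite -alal; ring.
have trmxD (A B : 'M[R[i]]_d) : (A + B)^T = A^T + B^T.
  by apply/matrixP => i j; rewrite !mxE.
have trmxZ z (A : 'M[R[i]]_d) : (z *: A)^T = z *: A^T.
  by apply/matrixP => i j; rewrite !mxE.
have ET : E^T = E by rewrite trmxD !trmx_delta.
have FT : F^T = F by rewrite trmxD !trmx_delta addrC.
have EJ : conj_mx E = E by rewrite /conj_mx map_mxD !map_delta_mx.
have FJ : conj_mx F = F by rewrite /conj_mx map_mxD !map_delta_mx.
have VT z : (V z)^T = V z by rewrite !trmxD !trmxZ trmx1 ET FT.
have VJ : conj_mx (V 'i) = V (- 'i).
  rewrite /conj_mx 2!map_mxD !map_mxZ map_mx1 -!/(conj_mx _) EJ FJ.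
  have -> : V (- 'i) = 1%:M + (al^* - 1^*) *: E + (al^* * 'i^*) *: F.
    by rewrite alJ conjC1 conjCi.
  by rewrite rmorphB rmorphM.
have VJV : conj_mx (V 'i) *m V 'i = 1%:M.
  have ii : - 'i * 'i = 1 :> R[i] by rewrite mulNr -expr2 sqrCi opprK.
  rewrite VJ VV ii addNr mul0r scale0r addr0.
  have -> : (1 + 1) / 2 - 1 = 0 :> R[i] by field.
  by rewrite scale0r addr0.
have VVJ := mulmx1C VJV.
have VVE : V 'i *m V 'i = 1%:M + (-1) *: E + 'i *: F.
  rewrite VV -expr2 sqrCi subrr mul0r sub0r; congr (_ + _ *: _).
  by field.
pose G := blockU 0 1 (-1) 0.
have GJ : conj_mx G = G.
  by rewrite conj_blockU !conjC0 conjCN1 conjC1.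
have GG : G *m conj_mx G = blockU (-1) 0 0 (-1).
  rewrite GJ mul_blockU !mul0r !mulr0 mul1r mulr1 !addr0 !add0r //.
have GU : unitary_mx G.
  by apply: unitary_blockU; rewrite ?conjCN1 !conjC0 ?conjC1 ?mulrNN
    !(mulr0, mul0r, mulr1, add0r, addr0).
pose U := V 'i *m G *m V 'i.
exists U; split.
  rewrite /unitary_mx /conj_mx /U !map_mxM -!/(conj_mx _) !trmx_mul.
  rewrite VJ VT -VJ !mulmxA.
  rewrite -(mulmxA (_ *m G)) VVJ mulmx1 -(mulmxA (V 'i)) GU mulmx1.
  exact: VVJ.
rewrite /coord_pt; congr (_, _).
  (* Cyclicity and [V conj(V) = 1] leave [tr (G conj(G)) = 1 - 2 k = 2 - d]. *)
  rewrite /conj_mx /U !map_mxM -!/(conj_mx _) !mulmxA.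
  rewrite -(mulmxA (_ *m G)) VVJ mulmx1 mxtrace_mulC !mulmxA VJV mul1mx GG.
  rewrite mxtrace_blockU raddfD raddfMn raddfD raddfN /= DE; field.
  by rewrite gt_eqF // addr_gt0 // mulr_gt0 // ltr0n.
(* By cyclicity this is [tr (V^2 G)] with [V^2 = 1 - E + i F]: the trace 1 of [G] is cancelled by
   its [i0] diagonal entry, and the other entries involved are 0. *)
have -> : \tr U = 0.
  rewrite mxtrace_mulC mulmxA VVE mxtrace_mulC /E /F.
  rewrite !mulmxDr mulmx1 -!scalemxAr !mulmxDr !mxtraceD !mxtraceZ !mxtraceD.
  rewrite !mxtrace_mul_delta mxtrace_blockU.
  rewrite !(block_mxEul, block_mxEur, block_mxEdl, block_mxEdr) !mxE /=.
  by rewrite mul0rn !addr0 mulN1r mulr0 addr0 mul0rn addr0 subrr.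
by rewrite /sqmod /= expr0n addr0 mul0r.
Qed.

End Witnesses.

(** * Convex combinations in the plane and on the line *)

Section Conv2.
Variables (R : realType).
Implicit Types (S T : R * R -> Prop).

Lemma conv2_sub S T p : (forall q, S q -> T q) -> conv2 S p -> conv2 T p.
Proof.
move=> ST [n [w [q [w_ge0 [w1 [Sq pE]]]]]]; exists n, w, q.
by do 3 split=> // ; move=> i; apply: ST.
Qed.

Lemma conv2_pair S a b t : 0 <= t -> t <= 1 -> S a -> S b ->
  conv2 S (t * a.1 + (1 - t) * b.1, t * a.2 + (1 - t) * b.2).
Proof.
move=> t_ge0 t_le1 Sa Sb.
exists 2%N, (fun i => if i == ord0 then t else 1 - t),
  (fun i => if i == ord0 then a else b).
rewrite !big_ord_recl !big_ord0 /= !addr0; split.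
  by move=> i; case: ifP; rewrite // subr_ge0.
by split; [rewrite addrC subrK | split=> // i; case: ifP].
Qed.

Lemma conv2_mem S a : S a -> conv2 S a.
Proof.
move=> Sa; have := conv2_pair ler01 (lexx 1) Sa Sa.
by rewrite subrr !mul0r !mul1r !addr0 -surjective_pairing.
Qed.

(** The nonnegative numbers [t (u - m)] and [(1 - t) (v - m)] sum to 0. Used coordinatewise at the
    corners. *)
Lemma convex_comb_min (m t u v : R) : 0 < t -> t < 1 -> m <= u -> m <= v ->
  m = t * u + (1 - t) * v -> u = m /\ v = m.
Proof.
move=> t_gt0 t_lt1 mu mv mE; have s_gt0 : 0 < 1 - t by rewrite subr_gt0.
have tu : 0 <= t * (u - m) by rewrite mulr_ge0 ?subr_ge0 // ltW.
have sv : 0 <= (1 - t) * (v - m) by rewrite mulr_ge0 ?subr_ge0 // ltW.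
have : t * (u - m) + (1 - t) * (v - m) == 0 by apply/eqP; rewrite {1 2}mE; ring.
rewrite paddr_eq0 // !mulf_eq0 (gt_eqF t_gt0) (gt_eqF s_gt0) /= !subr_eq0.
by case/andP=> /eqP -> /eqP ->.
Qed.

End Conv2.

(** * Determination of the extreme points *)

Theorem theorem5 (R : realType) (d : nat) (hd3 : (3 <= d)%N) (hodd : odd d)
  (p : R * R) :
  extreme_point (@Cset R d) p <->
  (p = (-1 + 2 / d%:R, 0) \/ p = (1, 0) \/
   exists x : R, -1 + 2 / d%:R <= x /\ x <= 1 /\
     p = (x, d%:R * mfun d x ^+ 2)).
Proof.
pose gen (q : R * R) := exists U : 'M[R[i]]_d, unitary_mx U /\ q = coord_pt U.
have C_region q : @Cset R d q -> in_region d q.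
  move=> Cq; apply: in_region_conv2 => //; apply: conv2_sub Cq => {}q [U [UU ->]].
  exact: coord_pt_in_region.
have dE : d = (1 + (d./2 + d./2))%N by rewrite addnn -{1}(odd_double_half d) hodd.
have k_gt0 : (0 < d./2)%N by rewrite half_gt0 ltnW.
have left_gen : gen (-1 + 2 / d%:R, 0).
  by rewrite /gen dE; exact: left_corner_attained.
have right_gen : gen (1, 0) by rewrite /gen dE; exact: right_corner_attained.
have curve_gen x : -1 + 2 / d%:R <= x -> x <= 1 -> gen (x, d%:R * mfun d x ^+ 2).
  by rewrite /gen dE; exact: curve_attained.
have width_gt0 : 0 < 2 - 2 / d%:R :> R.
  rewrite subr_gt0 ltr_pdivrMr ?ltr0n ?(ltnW (ltnW hd3)) // ltr_pMr // ltr1n.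
  exact: ltnW.
set l : R := -1 + 2 / d%:R in left_gen curve_gen *.
have bottom x : l <= x -> x <= 1 -> exists t, [/\ 0 <= t, t <= 1 &
    (x, 0) = (t * l + (1 - t) * 1, t * 0 + (1 - t) * 0)].
  (* The weight solves [x = 1 - t w], where [w = 2 - 2 / d] is the width of the bottom edge. *)
  move=> lx x1; exists ((1 - x) / (2 - 2 / d%:R)).
  rewrite !mulr0 addr0; split.
  - by rewrite mulr_ge0 ?invr_ge0 ?(ltW width_gt0) ?subr_ge0.
  - by rewrite (ler_pdivrMr _ _ width_gt0) mul1r; move: lx; rewrite /l; lra.
  congr (_, _); have -> : l = 1 - (2 - 2 / d%:R) by rewrite /l; ring.
  have := lt0r_neq0 width_gt0; move: (2 - _) => w w0.
  by field.
split; last first.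
- case=> [->|[->|[x [lx [x1 ->]]]]].
  + split; first exact: conv2_mem.
    case=> a1 a2 [b1 b2] t /C_region[/= la _ a0 _] /C_region[/= lb _ b0 _] t0 t1 [E1 E2].
    have [-> ->] := convex_comb_min t0 t1 la lb E1.
    by have [-> ->] := convex_comb_min t0 t1 a0 b0 E2.
  + split; first exact: conv2_mem.
    case=> a1 a2 [b1 b2] t /C_region[/= _ a1_le a0 _] /C_region[/= _ b1_le b0 _] t0 t1 [E1 E2].
    (* The abscissa is maximal here, so the minimum lemma is applied to the negatives. *)
    have [|||/oppr_inj-> /oppr_inj->] := @convex_comb_min _ (-1) t (- a1) (- b1) t0 t1.
    * by rewrite lerN2.
    * by rewrite lerN2.
    * by rewrite {1}E1; ring.
    by have [-> ->] := convex_comb_min t0 t1 a0 b0 E2.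
  split; first exact/conv2_mem/curve_gen.
  move=> a b t /C_region Ca /C_region Cb t0 t1.
  exact: curve_extreme.
case: p => x y [Cp ext].
have [/= lx x1 y_ge0 y_le] := C_region _ Cp.
have [t [t_ge0 t_le1 xE]] := bottom x lx x1.
have Cx : @Cset R d (x, 0).
  by rewrite xE; exact: (@conv2_pair _ _ (l, 0) (1, 0)).
have [y0|y_neq0] := eqVneq y 0.
  have [t0|t_neq0] := eqVneq t 0.
    by right; left; rewrite y0 xE t0; congr (_, _); ring.
  have [t1|t_neq1] := eqVneq t 1.
    by left; rewrite y0 xE t1; congr (_, _); ring.
  have t_gt0 : 0 < t by rewrite lt_def t_neq0.
  have t_lt1 : t < 1 by rewrite lt_def eq_sym t_neq1.
  (* Strictly between the corners, extremality forces the point to equal the left one, which is a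
     listed case. *)
  left; have [] := ext _ _ t (conv2_mem left_gen) (conv2_mem right_gen) t_gt0 t_lt1.
    by rewrite y0 xE.
  by move=> <-.
have [yf|y_neqf] := eqVneq y (d%:R * mfun d x ^+ 2).
  by right; right; exists x; rewrite yf.
have f_gt0 : 0 < d%:R * mfun d x ^+ 2 by exact: curve_gt0.
set f := _ * _ in f_gt0 y_le y_neqf.
right; right; exists x; do 2 split=> //.
(* Strictly between the bottom edge and the curve, the point splits vertically with weight [y / f]
   on the curve point, so extremality identifies it with that point. *)
have t'_gt0 : 0 < y / f by rewrite divr_gt0 // lt_def y_neq0.
have t'_lt1 : y / f < 1 by rewrite ltr_pdivrMr // mul1r lt_def eq_sym y_neqf.
have [|<- //] := ext _ _ _ (conv2_mem (curve_gen x lx x1)) Cx t'_gt0 t'_lt1.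
by rewrite /= -/f; congr (_, _); field; rewrite gt_eqF.
Qed.
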